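(* Let $0<\alpha<\pi/2$ and let $G$ be an $\alpha$AC graph with $n$ vertices. Then $G$ has at most $(\pi/\alpha)(3n-6)$ edges.
   Context: A geometric graph is a graph whose vertices are distinct points in $\mathbb{R}^2$ and whose edges are straight-line segments joining their endpoints. Two edges cross if the segments intersect at a point other than a common endpoint; the angle at which they cross is the (smaller) angle between the two segments, a value in $(0,\pi/2]$. For $\alpha>0$, a geometric graph is an $\alpha$ angle crossing ($\alpha$AC) graph if every pair of crossing edges crosses at an angle of at least $\alpha$.
   Formalization: The bound is stated for graphs with n ≥ 3 vertices; as written it fails for n = 0 and n = 1, where 3n − 6 is negative, and for n = 2 with one edge, where it is 0. *)

(* Defs.v *)
From mathcomp Require Import all_boot all_order all_algebra.
From mathcomp Require Import classical_sets reals trigo.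

Set Implicit Arguments.
Unset Strict Implicit.
Unset Printing Implicit Defensive.

Import Order.TTheory GRing.Theory Num.Theory.
Local Open Scope ring_scope.

Record geometric_graph (R : realType) := GeometricGraph {
  vertex : finType;
  pos : vertex -> 'rV[R]_2;
  edges : {set {set vertex}};
  pos_inj : injective pos;
  edges_card2 : forall e, e \in edges -> #|e| = 2%N
}.

Section Plane.
Variable R : realType.
Implicit Types u v a b c d p : 'rV[R]_2.

Definition segment a b : set 'rV[R]_2 :=
  [set p | exists2 t : R, 0 <= t <= 1 & p = (1 - t) *: a + t *: b]%classic.

Definition dot u v : R := \sum_(i < 2) u 0 i * v 0 i.

(* The Euclidean norm; [`|u|] on ['rV[R]_2] is the sup norm. *)
Definition enorm u : R := Num.sqrt (dot u u).

Definition vangle u v : R := acos (dot u v / (enorm u * enorm v)).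

(* The intersection point may be an endpoint of only one of the segments, and
   collinear segments that overlap cross, with [crossing_angle] equal to 0. *)
Definition segments_cross a b c d : Prop :=
  exists p, [/\ segment a b p, segment c d p &
    ~ ((p = a \/ p = b) /\ (p = c \/ p = d))].

(* The supporting lines form the angles [theta] and [pi - theta]. *)
Definition crossing_angle a b c d : R :=
  let theta := vangle (b - a) (d - c) in Num.min theta (pi - theta).

Definition is_alphaAC (alpha : R) (G : geometric_graph R) : Prop :=
  forall a b c d : vertex G,
    [set a; b] \in edges G -> [set c; d] \in edges G ->
    [set a; b] != [set c; d] ->
    segments_cross (pos a) (pos b) (pos c) (pos d) ->
    alpha <= crossing_angle (pos a) (pos b) (pos c) (pos d).

End Plane.

(* Main.v *)
(* Fix a direction and keep only the edges whose direction lies in a half-open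
   window of width at most [alpha]: no two of them cross, so they form a plane
   straight-line graph and number at most [3n - 6].  Averaging over the [N]
   windows starting at the multiples of [pi / N] and letting [N] tend to infinity
   gives the bound.

   The plane bound is obtained without Euler's formula.  After a generic shear,
   all abscissas are distinct.  The upper side of each edge [e] is charged to a
   vertex [v] that is neither leftmost nor rightmost, in one of three roles: [e]
   is the highest edge below [v], the highest edge leaving [v] to the right, or
   the highest edge leaving [v] to the left.  Each pair (vertex, role) is charged
   at most once, hence at most [3 (n - 2)] edges.  The charging can only fail for
   an edge joining the leftmost vertex to the rightmost one with all other
   vertices below it, in which case the drawing is reflected upside down. *)
Require Import Defs.
From mathcomp Require Import all_boot all_order all_algebra.
From mathcomp Require Import classical_sets reals trigo.
From mathcomp Require Import boolp lra ring zify.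

Import Order.TTheory GRing.Theory Num.Theory.
Local Open Scope ring_scope.

(** * Plane straight-line drawings, with edges as affine functions over intervals *)

Section StraightLineDrawing.
Context {R : realFieldType} {V : finType}.
Implicit Types (X Y : V -> R) (E : {set V * V}) (e f g : V * V) (t : R).

Definition slope X Y e : R := (Y e.2 - Y e.1) / (X e.2 - X e.1).
Definition height X Y e t : R := Y e.1 + slope X Y e * (t - X e.1).
Definition closed_span X e t := X e.1 <= t <= X e.2.
Definition open_span X e t := X e.1 < t < X e.2.

(* Edges are pairs (left endpoint, right endpoint); since [e] and [f] play
   symmetric roles, a meeting point is an endpoint of both. *)
Definition plane_drawing X Y E : Prop :=
  (forall e, e \in E -> X e.1 < X e.2) /\
  (forall e f t, e \in E -> f \in E -> e != f -> closed_span X e t -> closed_span X f t ->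
     height X Y e t = height X Y f t -> ~~ open_span X f t).

Lemma height_left X Y e : height X Y e (X e.1) = Y e.1.
Proof. by rewrite /height subrr mulr0 addr0. Qed.

Lemma height_right X Y e : X e.1 < X e.2 -> height X Y e (X e.2) = Y e.2.
Proof.
by move=> h; rewrite /height /slope; field; rewrite subr_eq0 gt_eqF.
Qed.

Lemma heightE_right X Y e t : X e.1 < X e.2 ->
  height X Y e t = Y e.2 + slope X Y e * (t - X e.2).
Proof.
by move=> h; rewrite /height /slope; field; rewrite subr_eq0 gt_eqF.
Qed.

Lemma open_spanW X e t : open_span X e t -> closed_span X e t.
Proof. by case/andP=> h1 h2; rewrite /closed_span !ltW. Qed.

(** The difference of two heights is affine in the abscissa, so its zero divides the interval in the
    ratio of [d1] to [d2]. As [d1] is positive so is [l], which keeps the meeting point away from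
    [t1]. *)
Lemma heights_meet X Y e f t1 t2 :
    height X Y e t1 < height X Y f t1 -> height X Y f t2 <= height X Y e t2 ->
  exists2 l : R, 0 < l <= 1 &
    height X Y e (t1 + l * (t2 - t1)) = height X Y f (t1 + l * (t2 - t1)).
Proof.
set d1 := height X Y f t1 - height X Y e t1.
set d2 := height X Y e t2 - height X Y f t2 => h1 h2.
have d1_gt0 : 0 < d1 by rewrite subr_gt0.
have d2_ge0 : 0 <= d2 by rewrite subr_ge0.
have d_gt0 : 0 < d1 + d2 by lra.
exists (d1 / (d1 + d2)).
  by rewrite divr_gt0 //= ler_pdivrMr //; lra.
have: d1 / (d1 + d2) * (d1 + d2) = d1 by rewrite divfK // gt_eqF.
move: (d1 / _) => l; rewrite /d1 /d2 /height; nra.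
Qed.

(** * Charging each edge of a plane drawing to a vertex and a role *)

Section PlaneDrawing.
Context {X Y : V -> R} {E : {set V * V}}.
Hypotheses (X_inj : injective X) (drawE : plane_drawing X Y E).
Local Notation ht := (height X Y).
Local Notation sl := (slope X Y).

Lemma edge_lt e : e \in E -> X e.1 < X e.2. Proof. exact: drawE.1. Qed.

Lemma between_open_span f t1 t2 (l : R) : 0 < l <= 1 ->
  closed_span X f t1 -> open_span X f t2 -> open_span X f (t1 + l * (t2 - t1)).
Proof. by rewrite /closed_span /open_span => *; apply/andP; split; nra. Qed.

Lemma between_span e t1 t2 (l : R) : 0 < l <= 1 ->
  closed_span X e t1 -> closed_span X e t2 -> closed_span X e (t1 + l * (t2 - t1)).
Proof. by rewrite /closed_span => *; apply/andP; split; nra. Qed.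

(** Otherwise the edges would meet between [t1] and [t2] but not at [t1], hence inside the open span
    of [f], where no other edge meets [f]. *)
Lemma stay_below {e f t1 t2} : e \in E -> f \in E ->
  closed_span X e t1 -> closed_span X e t2 -> closed_span X f t1 -> open_span X f t2 ->
  ht e t1 < ht f t1 -> ht e t2 < ht f t2.
Proof.
move=> eE fE se1 se2 sf1 sf2 lt1; rewrite ltNge; apply/negP => le2.
have nef : e != f by apply/eqP => ef; rewrite ef ltxx in lt1.
have [l l01 eq_l] := heights_meet _ _ _ _ _ _ lt1 le2.
have := drawE.2 e f _ eE fE nef (between_span _ _ _ _ l01 se1 se2)
  (open_spanW _ _ _ (between_open_span _ _ _ _ l01 sf1 sf2)) eq_l.
by rewrite between_open_span.
Qed.

Lemma stay_above {e f t1 t2} : e \in E -> f \in E ->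
  closed_span X e t1 -> closed_span X e t2 -> closed_span X f t1 -> open_span X f t2 ->
  ht f t1 < ht e t1 -> ht f t2 < ht e t2.
Proof.
move=> eE fE se1 se2 sf1 sf2 lt1; rewrite ltNge; apply/negP => le2.
have nef : e != f by apply/eqP => ef; rewrite ef ltxx in lt1.
have [l l01 eq_l] := heights_meet _ _ _ _ _ _ lt1 le2.
have := drawE.2 e f _ eE fE nef (between_span _ _ _ _ l01 se1 se2)
  (open_spanW _ _ _ (between_open_span _ _ _ _ l01 sf1 sf2)) (esym eq_l).
by rewrite between_open_span.
Qed.

(* [Y v] may equal the height: a vertex that is an endpoint of no edge can lie on [e]. *)
Definition top_below v e := [&& open_span X e (X v), ht e (X v) <= Y v &
  [forall (f | (f \in E) && open_span X f (X v)),
     (ht f (X v) <= Y v) ==> (ht f (X v) <= ht e (X v))]].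
Definition top_right v e :=
  (e.1 == v) && [forall (f | (f \in E) && (f.1 == v)), sl f <= sl e].
(** Going left from [v], the highest edge is the one of smallest slope. *)
Definition top_left v e :=
  (e.2 == v) && [forall (f | (f \in E) && (f.2 == v)), sl e <= sl f].

Definition charged e (s : option bool * V) :=
  match s.1 with
  | None => top_below s.2 e
  | Some true => top_right s.2 e
  | Some false => top_left s.2 e
  end.

Lemma top_below_inj v e f : e \in E -> f \in E ->
  top_below v e -> top_below v f -> e = f.
Proof.
move=> eE fE /and3P[se le_e /forall_inP Me] /and3P[sf le_f /forall_inP Mf].
apply/eqP; case: eqVneq => // nef.
have eqh : ht e (X v) = ht f (X v).
  apply/le_anti/andP; split.
    by apply: (implyP (Mf e _)) => //; rewrite eE.
  by apply: (implyP (Me f _)) => //; rewrite fE.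
by have := drawE.2 e f _ eE fE nef (open_spanW _ _ _ se) (open_spanW _ _ _ sf) eqh; rewrite sf.
Qed.

(** Two such edges overlap, so [e.2] lies on [f]; not being inside the open span of [f], it has the
    abscissa of [f.2], and [X] is injective. *)
Lemma same_left_slope e f : e \in E -> f \in E -> X e.2 <= X f.2 ->
  e.1 = f.1 -> sl e = sl f -> e = f.
Proof.
move=> eE fE le2 e1 es; apply/eqP; case: eqVneq => // nef.
have := drawE.2 e f (X e.2) eE fE nef; rewrite /closed_span /open_span -e1 le2 lexx.
rewrite !ltW ?edge_lt //= => /(_ isT isT).
rewrite /height es -e1 => /(_ erefl); rewrite -leNgt => ge2.
have e2 : e.2 = f.2 by apply/X_inj/le_anti/andP.
by move: nef; rewrite [e]surjective_pairing [f]surjective_pairing e1 e2 eqxx.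
Qed.

Lemma same_right_slope e f : e \in E -> f \in E -> X f.1 <= X e.1 ->
  e.2 = f.2 -> sl e = sl f -> e = f.
Proof.
move=> eE fE le1 e2 es; apply/eqP; case: eqVneq => // nef.
have ltf := edge_lt f fE; have lte := edge_lt e eE.
have := drawE.2 e f (X e.1) eE fE nef; rewrite /closed_span /open_span -e2 le1 lexx.
rewrite !ltW //= => /(_ isT isT).
rewrite !heightE_right // es -e2 => /(_ erefl); rewrite lte andbT -leNgt => ge1.
have e1 : e.1 = f.1 by apply/X_inj/le_anti/andP.
by move: nef; rewrite [e]surjective_pairing [f]surjective_pairing e1 e2 eqxx.
Qed.

Lemma top_right_inj v e f : e \in E -> f \in E ->
  top_right v e -> top_right v f -> e = f.
Proof.
move=> eE fE /andP[/eqP ev /forall_inP Me] /andP[/eqP fv /forall_inP Mf].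
have es : sl e = sl f.
  by apply/le_anti; rewrite Me ?Mf //= ?eE ?fE ?ev ?fv eqxx.
have e1 : e.1 = f.1 by rewrite ev fv.
have [le2|/ltW le2] := leP (X e.2) (X f.2); first exact: same_left_slope.
by apply/esym/same_left_slope.
Qed.

Lemma top_left_inj v e f : e \in E -> f \in E ->
  top_left v e -> top_left v f -> e = f.
Proof.
move=> eE fE /andP[/eqP ev /forall_inP Me] /andP[/eqP fv /forall_inP Mf].
have es : sl e = sl f.
  by apply/le_anti; rewrite Me ?Mf //= ?eE ?fE ?ev ?fv eqxx.
have e2 : e.2 = f.2 by rewrite ev fv.
have [le1|/ltW le1] := leP (X f.1) (X e.1); first exact: same_right_slope.
by apply/esym/same_right_slope.
Qed.

Lemma charged_inj s e f : e \in E -> f \in E ->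
  charged e s -> charged f s -> e = f.
Proof.
case: s => [[[]|] v]; rewrite /charged /=.
- exact: top_right_inj.
- exact: top_left_inj.
- exact: top_below_inj.
Qed.

Definition above e v := open_span X e (X v) && (ht e (X v) <= Y v).

(** An edge that runs over [e] somewhere cannot pass through [e] before reaching its own
    endpoint. *)
Lemma end_above {e} g t v : e \in E -> g \in E -> v = g.1 \/ v = g.2 ->
  closed_span X g t -> closed_span X e t -> open_span X e (X v) -> ht e t < ht g t ->
  above e v.
Proof.
move=> eE gE vg sg se ov ltt; rewrite /above ov /=.
have ltg := edge_lt g gE.
have sgv : closed_span X g (X v) by rewrite /closed_span; case: vg => ->; rewrite lexx ltW.
have := stay_above gE eE sg sgv se ov ltt.
by case: vg => ->; rewrite ?height_left ?height_right // => /ltW.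
Qed.

(** The leftmost vertex of [Q] works: an edge between it and [e] would, by the last hypothesis,
    yield a vertex of [Q] further left. *)
Lemma leftmost_top_below e (Q : pred V) z0 : Q z0 ->
    (forall z, Q z -> above e z) ->
    (forall z g, Q z -> g \in E -> open_span X g (X z) ->
       ht e (X z) < ht g (X z) -> ht g (X z) <= Y z ->
       exists2 z', Q z' & X z' < X z) ->
  exists z, top_below z e.
Proof.
move=> Qz0 Qabove Qstep; case: (arg_minP X Qz0) => z Qz zmin; exists z.
have /andP[oz lez] := Qabove z Qz.
rewrite /top_below oz lez; apply/forall_inP => g /andP[gE og].
apply/implyP => leg; rewrite leNgt; apply/negP => ltg.
have [z' Qz'] := Qstep z g Qz gE og ltg leg.
by rewrite ltNge zmin.
Qed.

(* [f] covers [e] and, at the abscissa of [w], bounds the face just above [e]. *)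
Definition roof e f w :=
  [/\ f \in E, X f.1 <= X e.1, X e.2 <= X f.2, open_span X e (X w) &
   [/\ ht e (X w) < ht f (X w),
     forall z, above e z -> ht f (X z) <= Y z &
     forall g, g \in E -> open_span X g (X w) -> ht e (X w) < ht g (X w) ->
       ht f (X w) <= ht g (X w)]].

(** Let [w] be the leftmost vertex above [e]. If another edge separates them, let [f] be the lowest
    edge over [e] at [w]. It starts no further right than [e], since otherwise [f.1] would be above
    [e] and left of [w]. If the pocket between [e] and [f] contains a vertex, its leftmost one has
    [e] as highest edge below; if not, [f] is a roof. *)
Lemma top_below_or_roof e w0 : e \in E -> above e w0 ->
  (exists v, top_below v e) \/ (exists f w, roof e f w).
Proof.
move=> eE aw0; case: (arg_minP X aw0) => w aw wmin.
have /andP[ow lew] := aw.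
case: (boolP (top_below w e)) => [tb|]; first by left; exists w.
rewrite /top_below ow lew /= => /forall_inPn[f0 /andP[f0E of0]].
rewrite negb_imply -ltNge => /andP[f0w ltf0].
pose P g := [&& g \in E, open_span X g (X w) & ht e (X w) < ht g (X w)].
have Pf0 : P f0 by apply/and3P.
case: (arg_minP (fun g => ht g (X w)) Pf0) => f /and3P[fE of_ ltf] fmin.
have fw : ht f (X w) <= Y w := le_trans (fmin _ Pf0) f0w.
have /andP[f1w wf2] := of_; have /andP[e1w we2] := ow.
have f1e1 : X f.1 <= X e.1.
  rewrite leNgt; apply/negP => lt1.
  have /wmin : above e f.1.
    apply: (end_above f (X w)) => //; [by left|exact: open_spanW..|].
    by rewrite /open_span lt1 (lt_trans f1w).
  by rewrite leNgt f1w.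
(* The pocket between [e] and [f]. Its right tip [f.2] lies on [f], so the strict inequality would
   miss it. *)
pose Q z := [&& above e z, X z <= X f.2 & (z == f.2) || (Y z < ht f (X z))].
case: (pickP Q) => [z0 Qz0|Q0]; [left|right].
  apply: (leftmost_top_below e Q z0) => //; first by move=> z /and3P[].
  move=> z g Qz gE og ltg leg; have /and3P[az zf2 zf] := Qz.
  have /andP[oz lez] := az; have /andP[e1z ze2] := oz.
  have /andP[g1z zg2] := og.
  have wz : X w < X z.
    rewrite lt_neqAle wmin // andbT; apply/eqP => /X_inj ewz; subst z.
    move: zf; rewrite ltNge fw orbF => /eqP ewf.
    by rewrite ewf ltxx in wf2.
  have sfz : closed_span X f (X z) by rewrite /closed_span zf2 (le_trans f1e1) // ltW.
  have gf : ht g (X z) < ht f (X z).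
    case/orP: zf => [/eqP ezf|]; last exact: le_lt_trans.
    rewrite lt_neqAle {4}ezf height_right ?edge_lt // -ezf leg andbT.
    apply/eqP => eqh; have nfg : f != g.
      by apply/eqP => efg; rewrite -efg ezf ltxx in zg2.
    have := drawE.2 f g (X z) fE gE nfg sfz (open_spanW _ _ _ og) (esym eqh).
    by rewrite og.
  (* Either [g] starts over [e], and [g.1] is a pocket vertex further left, or [g] extends back to
     the abscissa of [w] and runs there between [e] and [f], against the choice of [f]. *)
  have [lt1|le1] := ltP (X e.1) (X g.1).
    exists g.1 => //; rewrite /Q; apply/and3P; split.
    - apply: (end_above g (X z)) => //; [by left|exact: open_spanW..|].
      by rewrite /open_span lt1 (lt_trans g1z).
    - by rewrite (le_trans (ltW g1z)).
    apply/orP; right; rewrite -(height_left X Y g).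
    apply: (stay_below (t1 := X z)) => //; first exact: open_spanW.
      by rewrite /closed_span lexx ltW ?edge_lt.
    by rewrite /open_span (le_lt_trans f1e1) //= (lt_le_trans g1z).
  have ogw : open_span X g (X w).
    by rewrite /open_span (le_lt_trans le1) //= (lt_trans wz).
  have : ht g (X w) < ht f (X w).
    by apply: (stay_below (t1 := X z)) => //; exact: open_spanW.
  rewrite ltNge fmin //; apply/and3P; split=> //.
  by apply: (stay_above (t1 := X z)) => //; exact: open_spanW.
have e2f2 : X e.2 <= X f.2.
  rewrite leNgt; apply/negP => lt2; have := Q0 f.2.
  rewrite /Q lexx eqxx /= andbT => /negP; apply.
  apply: (end_above f (X w)) => //; [by right|exact: open_spanW..|].
  by rewrite /open_span lt2 (lt_trans e1w).
exists f, w; split=> //; split=> // [z az|g gE og ltg]; last first.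
  by apply: fmin; apply/and3P.
have /andP[/andP[_ ze2] _] := az.
rewrite leNgt; apply/negP => ltz; have := Q0 z.
by rewrite /Q az ltz orbT (le_trans (ltW ze2)).
Qed.

Lemma steeper_right e g t : g.1 = e.1 -> sl e < sl g -> X e.1 < t ->
  ht e t < ht g t.
Proof. by move=> eg lts ltt; rewrite /height eg ltrD2l ltr_pM2r // subr_gt0. Qed.

Lemma flatter_left e g t : e \in E -> g \in E ->
  g.2 = e.2 -> sl g < sl e -> t < X e.2 -> ht e t < ht g t.
Proof.
move=> eE gE eg lts ltt; rewrite !heightE_right ?edge_lt // eg ltrD2l.
by rewrite ltr_nM2r // subr_lt0.
Qed.

(** A steeper edge [g] leaving [e.1] would be trapped between [e] and [f]. Either it ends there, at
    a vertex above [e] but below [f], or it passes under [f] at the abscissa of [w]; a roof excludes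
    both. *)
Lemma roof_top_right e f w : e \in E -> roof e f w -> X f.1 < X e.1 ->
  top_right e.1 e.
Proof.
move=> eE [fE _ e2f2 ow [ltw fabove fmin]] f1e1.
have lte := edge_lt e eE; have /andP[e1w we2] := ow.
have sfw : open_span X f (X w).
  by rewrite /open_span (lt_trans f1e1) //= (lt_le_trans we2).
have ofe1 : open_span X f (X e.1).
  by rewrite /open_span f1e1 /= (lt_le_trans lte).
have fe1 : Y e.1 < ht f (X e.1).
  rewrite -(height_left X Y e).
  apply: (stay_below (t1 := X w)) => //; try exact: open_spanW.
  by rewrite /closed_span lexx ltW.
rewrite /top_right eqxx; apply/forall_inP => g /andP[gE /eqP g1].
rewrite leNgt; apply/negP => lts.
have ltg := edge_lt g gE; rewrite g1 in ltg.
rewrite -g1 -(height_left X Y g) g1 in fe1.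
have se1 : closed_span X g (X e.1) by rewrite /closed_span g1 lexx ltW.
have [lt2|le2] := ltP (X g.2) (X e.2).
  have ag : above e g.2.
    rewrite /above /open_span ltg lt2 /= -(height_right X Y g) ?edge_lt //.
    by apply/ltW/steeper_right.
  have := fabove _ ag; rewrite -(height_right X Y g) ?edge_lt // leNgt.
  rewrite (stay_below (t1 := X e.1)) //.
  - by rewrite /closed_span g1 lexx ltW.
  - exact: open_spanW.
  by rewrite /open_span (lt_trans f1e1) //= (lt_le_trans lt2).
have ogw : open_span X g (X w).
  by rewrite /open_span g1 e1w /= (lt_le_trans we2).
have := fmin _ gE ogw (steeper_right _ _ _ g1 lts e1w).
by rewrite leNgt (stay_below (t1 := X e.1)) //; exact: open_spanW.
Qed.

(** Mirror image of [roof_top_right]. *)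
Lemma roof_top_left e f w : e \in E -> roof e f w -> X e.2 < X f.2 ->
  top_left e.2 e.
Proof.
move=> eE [fE f1e1 _ ow [ltw fabove fmin]] e2f2.
have lte := edge_lt e eE; have /andP[e1w we2] := ow.
have sfw : open_span X f (X w).
  by rewrite /open_span (le_lt_trans f1e1) //= (lt_trans we2).
have ofe2 : open_span X f (X e.2).
  by rewrite /open_span e2f2 (le_lt_trans f1e1).
have fe2 : Y e.2 < ht f (X e.2).
  rewrite -(height_right X Y e) //.
  apply: (stay_below (t1 := X w)) => //; try exact: open_spanW.
  by rewrite /closed_span lexx ltW.
rewrite /top_left eqxx; apply/forall_inP => g /andP[gE /eqP g2].
rewrite leNgt; apply/negP => lts.
have ltg := edge_lt g gE.
rewrite -g2 -(height_right X Y g) // g2 in fe2.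
rewrite g2 in ltg.
have se2 : closed_span X g (X e.2) by rewrite /closed_span g2 lexx ltW.
have [lt1|le1] := ltP (X e.1) (X g.1).
  have ag : above e g.1.
    rewrite /above /open_span ltg lt1 /= -(height_left X Y g).
    by apply/ltW/flatter_left.
  have := fabove _ ag; rewrite -(height_left X Y g) leNgt.
  rewrite (stay_below (t1 := X e.2)) //.
  - by rewrite /closed_span g2 lexx ltW.
  - exact: open_spanW.
  by rewrite /open_span (le_lt_trans f1e1) //= (lt_trans ltg).
have ogw : open_span X g (X w).
  by rewrite /open_span g2 we2 (le_lt_trans le1).
have := fmin _ gE ogw (flatter_left _ _ _ eE gE g2 lts we2).
by rewrite leNgt (stay_below (t1 := X e.2)) //; exact: open_spanW.
Qed.

Definition inner : {set V} :=
  [set v | [exists u, X u < X v] && [exists u, X v < X u]].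

Lemma mem_inner u v u' : X u < X v -> X v < X u' -> v \in inner.
Proof.
by move=> uv vu'; rewrite inE; apply/andP; split; apply/existsP;
  [exists u|exists u'].
Qed.

Lemma pair_inj e f : e.1 = f.1 -> e.2 = f.2 -> e = f.
Proof. by case: e f => [a b] [c d] /= -> ->. Qed.

(** An edge that leaves one endpoint of [e] on the upper side must reach strictly beyond the other
    endpoint, as it would otherwise end above [e]. So if [e] is not topmost at one end, the other
    end is an inner vertex. *)
Lemma open_sky_charged e : e \in E -> (forall w, ~~ above e w) ->
    e.1 \in inner \/ e.2 \in inner ->
  exists2 s, s.2 \in inner & charged e s.
Proof.
move=> eE sky inn; have lte := edge_lt e eE.
have longR g : g \in E -> g.1 = e.1 -> sl e < sl g -> X e.2 < X g.2.
  move=> gE g1 lts; have ltg := edge_lt g gE.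
  have [//|lt2|/X_inj eq2] := ltgtP (X e.2) (X g.2).
    case/negP: (sky g.2); rewrite /above /open_span lt2 -g1 ltg /=.
    by rewrite -(height_right X Y g) // ltW // steeper_right // -g1.
  by move: lts; rewrite (pair_inj e g) ?ltxx.
have longL g : g \in E -> g.2 = e.2 -> sl g < sl e -> X g.1 < X e.1.
  move=> gE g2 lts; have ltg := edge_lt g gE.
  have [//|lt1|/X_inj eq1] := ltgtP (X g.1) (X e.1).
    case/negP: (sky g.1); rewrite /above /open_span lt1 -g2 ltg /=.
    by rewrite -(height_left X Y g) ltW // flatter_left // -g2.
  by move: lts; rewrite (pair_inj e g) ?ltxx.
have [tr|ntr] := boolP (top_right e.1 e); have [tl|ntl] := boolP (top_left e.2 e).
- by case: inn => v_in; [exists (Some true, e.1)|exists (Some false, e.2)].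
- move: ntl; rewrite /top_left eqxx => /forall_inPn[g /andP[gE /eqP g2]].
  rewrite -ltNge => lts; exists (Some true, e.1) => //=.
  exact: (mem_inner _ _ _ (longL g gE g2 lts) lte).
- move: ntr; rewrite /top_right eqxx => /forall_inPn[g /andP[gE /eqP g1]].
  rewrite -ltNge => lts; exists (Some false, e.2) => //=.
  exact: (mem_inner _ _ _ lte (longR g gE g1 lts)).
(* The steeper edge leaving [e.1] and the flatter edge entering [e.2] cross. *)
move: ntr; rewrite /top_right eqxx => /forall_inPn[g /andP[gE /eqP g1]].
move: ntl; rewrite /top_left eqxx => /forall_inPn[k /andP[kE /eqP k2]].
rewrite -!ltNge => ltsk ltsg.
have k1e1 := longL k kE k2 ltsk; have e2g2 := longR g gE g1 ltsg.
have : ht g (X e.2) < ht k (X e.2).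
  apply: (stay_above (t1 := X e.1)) => //; rewrite /closed_span /open_span.
  - by rewrite ltW // k2 ltW.
  - by rewrite k2 lexx andbT ltW // (lt_trans k1e1).
  - by rewrite g1 lexx ltW // (lt_trans lte).
  - by rewrite g1 lte.
  by rewrite -{1}g1 height_left g1 -(height_left X Y e) flatter_left.
rewrite -{2}k2 height_right ?edge_lt // k2 -(height_right X Y e) // ltNge.
by rewrite ltW // steeper_right.
Qed.

(** A roof differs from [e], so it sticks out beyond [e] on at least one side; the endpoint of [e]
    on that side is inner and has [e] as its topmost edge. *)
Lemma edge_charged e : e \in E ->
    (exists w, above e w) \/ (e.1 \in inner \/ e.2 \in inner) ->
  exists2 s, s.2 \in inner & charged e s.
Proof.
move=> eE he; have lte := edge_lt e eE.
have [/existsP[w aw]|/existsPn sky] := boolP [exists w, above e w]; last first.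
  apply: open_sky_charged => //; case: he => // -[w aw].
  by have := sky w; rewrite aw.
have [[v tb]|[f [u rf]]] := top_below_or_roof e w eE aw.
  exists (None, v) => //=; have /and3P[/andP[e1v ve2] _ _] := tb.
  exact: mem_inner e1v ve2.
have [fE f1e1 e2f2 ow [ltw _ _]] := rf.
have [lt1||/X_inj eq1] := ltgtP (X f.1) (X e.1); first 1 last.
- by rewrite ltNge f1e1.
- have [lt2||/X_inj eq2] := ltgtP (X e.2) (X f.2).
  + exists (Some false, e.2); first exact: mem_inner lte lt2.
    exact: roof_top_left rf lt2.
  + by rewrite ltNge e2f2.
  + by move: ltw; rewrite (pair_inj e f) ?ltxx.
- exists (Some true, e.1); first exact: mem_inner lt1 lte.
  exact: roof_top_right rf lt1.
Qed.

End PlaneDrawing.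

(** * Counting the charges: the bound for plane drawings *)

Lemma leq_card_rel (S T : finType) (A : {set S}) (B : {set T}) (r : S -> T -> bool) :
    (forall x, x \in A -> exists2 y, y \in B & r x y) ->
    (forall x x' y, x \in A -> x' \in A -> r x y -> r x' y -> x = x') ->
  (#|A| <= #|B|)%N.
Proof.
move=> tot inj; pose F x := [pick y in B | r x y].
have FP x : x \in A -> exists y, [/\ F x = Some y, y \in B & r x y].
  move=> /tot[y yB rxy]; rewrite /F; case: pickP => [z /andP[zB rxz]|/(_ y)].
    by exists z.
  by rewrite yB rxy.
rewrite -(card_in_imset (f := F)) => [|x x' xA x'A].
  rewrite -(card_imset B Some_inj); apply/subset_leq_card/fintype.subsetP => o.
  by case/imsetP=> x /FP[y [-> yB _]] ->; apply: imset_f.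
have [y [-> _ rxy]] := FP x xA; have [y' [-> _ rxy']] := FP x' x'A.
by case=> eqy; apply: (inj x x' y') => //; rewrite -eqy.
Qed.

Lemma card_inner X : injective X -> (1 < #|V|)%N ->
  (#|inner (X := X)| <= #|V| - 2)%N.
Proof.
move=> X_inj V_gt1; have [v0 _] : {v0 : V | v0 \in V}.
  by case: (pickP V) => [v|/eq_card0 V0]; [exists v | rewrite V0 in V_gt1].
have [p _ pmin] := @arg_minP _ _ _ v0 xpredT X isT.
have [q _ qmax] := @arg_maxP _ _ _ v0 xpredT X isT.
have npq : p != q.
  apply/eqP => epq; have: (#|V| <= 1)%N.
    apply/card_le1_eqP => x y _ _; apply: X_inj; apply/le_anti.
    have := (pmin x isT, qmax x isT, pmin y isT, qmax y isT).
    by rewrite epq => -[[[a b] c] d]; rewrite (le_trans b c) (le_trans d a).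
  by rewrite leqNgt V_gt1.
have sub : inner (X := X) \subset ~: [set p; q].
  apply/fintype.subsetP => v; rewrite !inE => /andP[/existsP[u uv] /existsP[u' vu']].
  apply/negP => /orP[] /eqP ev; subst v.
    by move: uv; rewrite ltNge pmin.
  by move: vu'; rewrite ltNge; have /= -> := qmax u' isT.
have := subset_leq_card sub; have := cardsC [set p; q].
by rewrite cards2 npq => <-; rewrite addKn.
Qed.

Lemma card_charged X Y E : injective X -> plane_drawing X Y E -> (1 < #|V|)%N ->
    (forall e, e \in E -> (exists w, above (X := X) (Y := Y) e w) \/
       (e.1 \in inner (X := X) \/ e.2 \in inner (X := X))) ->
  (#|E| <= 3 * (#|V| - 2))%N.
Proof.
move=> X_inj drawE V_gt1 H.
apply: (@leq_trans (3 * #|inner (X := X)|)); last by rewrite leq_mul2l card_inner.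
(* The factor 3 is the number of roles, that is, of elements of [option bool]. *)
have -> : (3 * #|inner (X := X)| = #|finset.setX [set: option bool] (inner (X := X))|)%N.
  by rewrite cardsX cardsT card_option card_bool.
apply: (leq_card_rel _ _ _ _ (charged (X := X) (Y := Y) (E := E))).
  move=> e eE; have [s s_in es] := edge_charged X_inj drawE e eE (H e eE).
  by exists s => //; rewrite !inE in s_in *.
by move=> e f s eE fE; apply: charged_inj.
Qed.

Lemma plane_drawing_flip X Y E :
  plane_drawing X Y E -> plane_drawing X (fun v => - Y v) E.
Proof.
case=> lt nc; split=> // e f t eE fE nef se sf eqh; apply: (nc e) => //.
apply: oppr_inj; have hN g : height X (fun v => - Y v) g t = - height X Y g t.
  by rewrite /height /slope; ring.
by rewrite -!hN.
Qed.

Lemma card_plane_drawing X Y E : injective X -> plane_drawing X Y E ->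
  (2 < #|V|)%N -> (#|E| <= 3 * (#|V| - 2))%N.
Proof.
move=> X_inj drawE V_gt2; have V_gt1 := ltnW V_gt2.
pose good Y' e := [exists w, above (X := X) (Y := Y') e w] ||
  ((e.1 \in inner (X := X)) || (e.2 \in inner (X := X))).
have [/forall_inP ok|] := boolP [forall (e | e \in E), good Y e].
  apply: (card_charged X Y) => // e /ok/orP[/existsP|/orP]; by [left|right].
case/forall_inPn=> e eE; rewrite !negb_or => /and3P[/existsPn sky n1 n2].
have lte := drawE.1 e eE.
have all_span v : closed_span X e (X v).
  rewrite /closed_span !leNgt; apply/andP; split; apply/negP => ltv.
    by case/negP: n1; apply: mem_inner ltv lte.
  by case/negP: n2; apply: mem_inner lte ltv.
(* Here [e] joins the leftmost vertex to the rightmost one. Every other edge has an inner endpoint,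
   and after the reflection [e] itself has a third vertex above it. *)
apply: (card_charged X (fun v => - Y v)) => //; first exact: plane_drawing_flip.
move=> f fE; have ltf := drawE.1 f fE.
have /andP[] := all_span f.1; rewrite le_eqVlt => /orP[/eqP/X_inj eq1|lt1] _;
  last by right; left; apply: mem_inner lt1 ltf.
have /andP[_] := all_span f.2; rewrite le_eqVlt => /orP[/eqP/X_inj eq2|lt2];
  last by right; right; apply: mem_inner ltf lt2.
have efE : e = f by apply: pair_inj.
have /card_gt0P[v] : (0 < #|~: [set e.1; e.2]|)%N.
  have := cardsC [set e.1; e.2]; rewrite cards2.
  by case: (e.1 != e.2); lia.
rewrite !inE negb_or => /andP[v1 v2]; left; exists v; rewrite -efE.
have ov : open_span X e (X v).
  have /andP[a b] := all_span v.
  by rewrite /open_span !lt_neqAle a b !(inj_eq X_inj) v2 eq_sym v1.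
rewrite /above ov /=; have := sky v; rewrite /above ov /= -ltNge.
rewrite -lerN2 opprK => /ltW; congr (_ <= _).
by rewrite /height /slope; ring.
Qed.

End StraightLineDrawing.

(** * Averaging over cyclic windows *)

Section CyclicWindows.

(** Double counting: modulo [N.+1], each residue lies in exactly [M] of the windows of [M]
    consecutive residues, since [M] is at most [N.+1]. *)
Lemma card_cyclic_windows (T : finType) (A : {set T}) (N M K : nat)
    (b : T -> 'I_N.+1) : (M <= N.+1)%N ->
  (forall j : 'I_N.+1, #|[set x in A | ((b x - j)%R < M)%N]| <= K)%N ->
  (#|A| * M <= N.+1 * K)%N.
Proof.
move=> leM win.
have windows_of i : (\sum_(j : 'I_N.+1 | ((i - j)%R < M)%N) 1 = M)%N.
  rewrite (reindex_inj (inv_inj (subKr i))).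
  under eq_bigl do rewrite subKr.
  by rewrite -(big_ord_widen N.+1 (fun=> 1%N)) // sum_nat_const card_ord muln1.
rewrite -sum_nat_const.
rewrite (eq_bigr _ (fun x _ => esym (windows_of (b x)))).
rewrite (exchange_big_dep xpredT) //=.
apply: (@leq_trans (\sum_(j < N.+1) K)%N); last by rewrite sum_nat_const card_ord.
apply: leq_sum => j _; apply: leq_trans (win j).
by rewrite -sum1_card; apply/eq_leq/eq_bigl => x; rewrite inE.
Qed.

Lemma ord_subE N (i j : 'I_N.+1) :
  (i - j)%R = (if (j <= i)%N then i - j else i + N.+1 - j)%N :> nat.
Proof.
have ltj := ltn_ord j; have lti := ltn_ord i.
rewrite /= modnDmr; case: leqP => [le_ji|lt_ij].
  have -> : (i + (N.+1 - j) = i - j + N.+1)%N by lia.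
  by rewrite modnDr modn_small //; lia.
by rewrite modn_small; lia.
Qed.

End CyclicWindows.

(** * Directions of lines modulo [pi], and crossing angles *)

Section Directions.
Context {R : realType}.
Implicit Types (u v : 'rV[R]_2) (s t : R).

(** The factor [r] may be negative: [t] is the angle of the line spanned by [u], determined only
    modulo [pi]. *)
Definition has_direction u t :=
  exists2 r : R, r != 0 & u 0 0 = r * cos t /\ u 0 1 = r * sin t.

Lemma row2P u v : u 0 0 = v 0 0 -> u 0 1 = v 0 1 -> u = v.
Proof.
move=> e0 e1; apply/rowP => i; case: (unliftP 0 i) => [j|] ->; last exact: e0.
by rewrite (ord1 j) (_ : lift 0 0 = 1) //; apply: val_inj.
Qed.

Lemma dotE u v : dot u v = u 0 0 * v 0 0 + u 0 1 * v 0 1.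
Proof.
rewrite /dot big_ord_recl big_ord1 (_ : lift ord0 ord0 = 1) //.
exact: val_inj.
Qed.

Lemma direction_exists u : u != 0 ->
  exists2 t, 0 <= t < pi & has_direction u t.
Proof.
move=> u0; have [y0|y_neq0] := eqVneq (u 0 1) 0.
  exists 0; first by rewrite lexx pi_gt0.
  exists (u 0 0); last by rewrite cos0 sin0 mulr1 mulr0.
  by apply: contraNneq u0 => x0; apply/eqP/row2P; rewrite mxE.
(* The cotangent of [z + pi / 2] is [- tan z], here the ratio of abscissa to ordinate; this puts the
   angle strictly between 0 and [pi] whatever the signs. *)
set z := atan (- (u 0 0 / u 0 1)).
have cz : 0 < cos z by rewrite cos_gt0_pihalf // atan_gtNpi2 atan_ltpi2.
have cz0 : cos z != 0 by rewrite gt_eqF.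
have tz : sin z / cos z = - (u 0 0 / u 0 1) by rewrite -[LHS]/(tan z) atanK.
exists (z + pi / 2).
  by have := atan_gtNpi2 (- (u 0 0 / u 0 1)); have := atan_ltpi2 (- (u 0 0 / u 0 1)); rewrite -/z; lra.
exists (u 0 1 / cos z); first by rewrite mulf_neq0 ?invr_eq0.
rewrite cosDpihalf sinDpihalf divfK //; split=> //.
have -> : u 0 1 / cos z * - sin z = - (u 0 1 * (sin z / cos z)) by ring.
by rewrite tz; field.
Qed.

Lemma has_directionN u t : has_direction u t -> has_direction (- u) t.
Proof.
case=> r r0 [ux uy]; exists (- r); rewrite ?oppr_eq0 // !mxE ux uy.
by rewrite !mulNr.
Qed.

Lemma has_directionDpi u t : has_direction u t -> has_direction u (t + pi).
Proof.
case=> r r0 [ux uy]; exists (- r); rewrite ?oppr_eq0 // ux uy cosDpi sinDpi.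
by rewrite !mulrNN.
Qed.

Lemma enorm_direction u r t : u 0 0 = r * cos t -> u 0 1 = r * sin t ->
  enorm u = `|r|.
Proof.
move=> ux uy; rewrite /enorm dotE ux uy -sqrtr_sqr; congr Num.sqrt.
by rewrite -[RHS]mulr1 -(cos2Dsin2 t); ring.
Qed.

(** According to the sign of [r * q], the angle between the vectors is [|s - t|] or its supplement;
    the minimum absorbs this ambiguity. The bound by [pi] lets [acos] invert [cos]. *)
Lemma crossing_angle_le (a b c d : 'rV[R]_2) s t :
    has_direction (b - a) s -> has_direction (d - c) t -> `|s - t| <= pi ->
  crossing_angle a b c d <= `|s - t|.
Proof.
case=> r r0 [ux uy] [q q0 [vx vy]] st.
have cK : acos (cos `|s - t|) = `|s - t| by apply: cosK; rewrite in_itv /= normr_ge0.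
rewrite /crossing_angle /vangle dotE (enorm_direction _ _ _ ux uy).
rewrite (enorm_direction _ _ _ vx vy) -normrM ux uy vx vy.
have -> : r * cos s * (q * cos t) + r * sin s * (q * sin t) = r * q * cos (s - t).
  by rewrite cosB; ring.
rewrite -[cos (s - t)]cos_norm; have rq0 : r * q != 0 by rewrite mulf_neq0.
have [rq|rq] := ger0P (r * q).
  by rewrite mulrAC divff // mul1r cK ge_min lexx.
rewrite invrN mulrN mulrAC divff // mul1r acosN ?cK ?cos_geN1 ?cos_le1 //.
by rewrite subKr ge_min lexx orbT.
Qed.

End Directions.

(** * From noncrossing segments to a plane drawing *)

Section NoncrossingFamily.
Context {R : realType} {V : finType} {pos : V -> 'rV[R]_2}.
Hypothesis pos_inj : injective pos.

Lemma generic_shear :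
  exists t : R, injective (fun v => pos v 0 0 + t * pos v 0 1).
Proof.
pose bad (p : V * V) :=
  (pos p.1 0 0 - pos p.2 0 0) / (pos p.2 0 1 - pos p.1 0 1).
(* Two points with distinct ordinates get the same abscissa for the single value [bad] only, and
   this [t] exceeds all those values. *)
exists (1 + \sum_p `|bad p|) => u v /=; set t := 1 + _ => euv.
have lt_bad p : bad p < t.
  rewrite /t (bigD1 p) //= addrCA; apply: le_lt_trans (ler_norm _) _.
  by rewrite ltrDl ltr_pwDl // sumr_ge0.
have [ey|ney] := eqVneq (pos u 0 1) (pos v 0 1).
  by apply: pos_inj; apply: row2P => //; move: euv; rewrite ey => /addIr.
have := lt_bad (u, v); rewrite (_ : bad (u, v) = t) ?ltxx // /bad /=.
have nz : pos v 0 1 - pos u 0 1 != 0 by rewrite subr_eq0 eq_sym.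
by apply: (mulIf nz); rewrite divfK //; lra.
Qed.

Lemma endpoints_inj (X : V -> R) (e f : V * V) : X e.1 < X e.2 ->
  X f.1 < X f.2 -> [set e.1; e.2] = [set f.1; f.2] -> e = f.
Proof.
case: e f => [a b] [c d] /= ltab ltcd eqs.
have : a \in [set c; d] by rewrite -eqs set21.
have : b \in [set c; d] by rewrite -eqs set22.
rewrite !inE => /orP[] /eqP eb /orP[] /eqP ea; subst => //.
- by rewrite ltxx in ltab.
- by have := lt_trans ltab ltcd; rewrite ltxx.
by rewrite ltxx in ltab.
Qed.

Lemma card_noncrossing (E : {set {set V}}) : (2 < #|V|)%N ->
    (forall e, e \in E -> #|e| = 2) ->
    (forall a b c d, [set a; b] \in E -> [set c; d] \in E ->
      [set a; b] != [set c; d] ->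
      ~ segments_cross (pos a) (pos b) (pos c) (pos d)) ->
  (#|E| <= 3 * (#|V| - 2))%N.
Proof.
move=> V_gt2 E2 nc; have [t X_inj] := generic_shear.
set X := fun v => _ in X_inj; pose Y v := pos v 0 1.
pose E' := [set e : V * V | (X e.1 < X e.2) && ([set e.1; e.2] \in E)].
apply: (@leq_trans #|E'|).
  apply: leq_trans (leq_imset_card (fun e : V * V => [set e.1; e.2]) E').
  apply/subset_leq_card/fintype.subsetP => e eE.
  have /eqP/cards2P[a [b [nab eab]]] := E2 e eE; rewrite eab in eE *.
  have [lt|lt|/X_inj eq] := ltgtP (X a) (X b); last by rewrite eq eqxx in nab.
    by apply/imsetP; exists (a, b); rewrite ?inE ?lt.
  by apply/imsetP; exists (b, a); rewrite /= ?inE ?lt /= finset.setUC.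
apply: (card_plane_drawing X Y) => //; split=> [e|]; first by rewrite inE => /andP[].
have pos0 v : pos v 0 0 = X v - t * Y v by rewrite /X /Y addrK.
(* The point of the original segment whose sheared abscissa is [x]; the shear leaves ordinates
   unchanged, so equal heights at [x] mean a common point. *)
pose point e x := (1 - (x - X e.1) / (X e.2 - X e.1)) *: pos e.1 +
  ((x - X e.1) / (X e.2 - X e.1)) *: pos e.2.
have pointP e x : X e.1 < X e.2 ->
    point e x 0 1 = height X Y e x /\ point e x 0 0 = x - t * height X Y e x.
  move=> lte; rewrite !mxE !pos0 -/(Y e.1) -/(Y e.2) /height /slope.
  by split; field; rewrite subr_eq0 gt_eqF.
have point_seg e x : X e.1 < X e.2 -> closed_span X e x ->
    segment (pos e.1) (pos e.2) (point e x).
  move=> lte /andP[le1 le2]; exists ((x - X e.1) / (X e.2 - X e.1)) => //.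
  have d0 : 0 < X e.2 - X e.1 by rewrite subr_gt0.
  by rewrite ler_pdivrMr // mul1r lerD2r le2 divr_ge0 ?subr_ge0 // ltW.
move=> e f x; rewrite !inE => /andP[lte eE] /andP[ltf fE] nef se sf eqh.
apply/negP => /andP[f1x xf2].
have nef' : [set e.1; e.2] != [set f.1; f.2].
  by apply: contraNneq nef => /(endpoints_inj X _ _ lte ltf) ->.
have [p1 p0] := pointP e x lte; have [q1 q0] := pointP f x ltf.
have pq : point e x = point f x by apply: row2P; rewrite ?p1 ?p0 ?q1 ?q0 eqh.
apply: (nc _ _ _ _ eE fE nef'); exists (point e x); split.
- exact: point_seg.
- by rewrite pq; apply: point_seg.
(* The common point is no endpoint of [f], because [x] is strictly inside its span. *)
have Xpoint v : point e x = pos v -> x = X v.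
  by rewrite /X => <-; rewrite p0 p1 subrK.
by case=> _ [] /Xpoint ex; rewrite -ex ltxx in f1x xf2.
Qed.

End NoncrossingFamily.

(** * Edges of an angle crossing graph grouped by direction *)

Section AngleCrossingGraphs.
Context {R : realType} {alpha : R} {G : geometric_graph R}.
Hypothesis alphaAC : is_alphaAC alpha G.
Local Notation V := (vertex G).

(** Both orders of the endpoints are covered; this is consistent because opposite vectors share
    their directions. *)
Definition edge_direction (e : {set V}) (t : R) : Prop :=
  forall a b : V, e = [set a; b] -> has_direction (pos b - pos a) t.

Lemma edge_direction_exists e : e \in edges G ->
  exists2 t, 0 <= t < pi & edge_direction e t.
Proof.
move=> /edges_card2/eqP/cards2P[a [b [nab ->]]].
have [|t t_pi dir] := direction_exists (pos b - pos a).
  by rewrite subr_eq0 (inj_eq (@pos_inj _ G)) eq_sym.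
exists t => // c d eqs; have nba : b != a by rewrite eq_sym.
have : a \in [set c; d] by rewrite -eqs set21.
have : b \in [set c; d] by rewrite -eqs set22.
rewrite !inE => /orP[] /eqP eb /orP[] /eqP ea; subst => //.
- by rewrite eqxx in nab.
- by rewrite -opprB; apply: has_directionN.
by rewrite eqxx in nab.
Qed.

(** Two directions in the half-open window differ by less than [alpha], so a crossing would have too
    small an angle. *)
Lemma card_window (x : R) (W : {set {set V}}) : (2 < #|V|)%N -> alpha <= pi ->
    (forall e, e \in W -> e \in edges G) ->
    (forall e, e \in W -> exists2 t, x <= t < x + alpha & edge_direction e t) ->
  (#|W| <= 3 * (#|V| - 2))%N.
Proof.
move=> V_gt2 alpha_pi sub dir.
apply: (card_noncrossing (@pos_inj _ G)) => // [e /sub/edges_card2 //|].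
move=> a b c d abW cdW nab cross.
have := alphaAC a b c d (sub _ abW) (sub _ cdW) nab cross.
have [s s_win /(_ a b erefl) dir_s] := dir _ abW.
have [t t_win /(_ c d erefl) dir_t] := dir _ cdW.
have st : `|s - t| < alpha by rewrite ltr_norml; lra.
have := crossing_angle_le _ _ _ _ _ _ dir_s dir_t (ltW (lt_le_trans st alpha_pi)).
by move=> le1 le2; have := le_trans le2 le1; rewrite leNgt st.
Qed.

(** The half-turn is cut into [N.+1] cells of width [w]. Rounding down makes [M] consecutive cells
    fit in a window of width [alpha], and the cyclic average applies to the cell indices. *)
Lemma card_edges_windows (N : nat) : 0 < alpha -> alpha <= pi -> (2 < #|V|)%N ->
  (#|edges G| * Num.truncn (alpha / (pi / N.+1%:R)) <=
     N.+1 * (3 * (#|V| - 2)))%N.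
Proof.
move=> alpha_gt0 alpha_pi V_gt2; set w := pi / N.+1%:R; set M := Num.truncn _.
have w_gt0 : 0 < w by rewrite divr_gt0 ?pi_gt0.
have Nw : N.+1%:R * w = pi by rewrite /w mulrC divfK ?pnatr_eq0.
have MwP : M%:R * w <= alpha.
  by rewrite -ler_pdivlMr // truncn_le divr_ge0 // ltW.
have leMN : (M <= N.+1)%N.
  by rewrite -(ler_nat R) -(ler_pM2r w_gt0) Nw (le_trans MwP).
have /choice[th thP] : forall e, exists t, e \in edges G ->
    0 <= t < pi /\ edge_direction e t.
  move=> e; have [eG|] := boolP (e \in edges G); last by exists 0.
  by have [t] := edge_direction_exists e eG; exists t.
have quoP t : 0 <= t < pi -> [/\ (Num.truncn (t / w) < N.+1)%N,
    (Num.truncn (t / w))%:R * w <= t & t < (Num.truncn (t / w)).+1%:R * w].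
  move=> /andP[t_ge0 t_pi]; have tw_ge0 : 0 <= t / w by rewrite divr_ge0 // ltW.
  rewrite -ler_pdivlMr // -ltr_pdivrMr // truncn_le tw_ge0 truncnS_gt; split=> //.
  by rewrite truncn_lt_nat // ltr_pdivrMr // Nw.
pose b e : 'I_N.+1 := inord (Num.truncn (th e / w)).
apply: (card_cyclic_windows _ _ _ _ _ b) => // j.
apply: (card_window (j%:R * w)) => // e; rewrite inE => /andP[eG //].
have [th_pi dir] := thP e eG; have [ltN le_th lt_th] := quoP _ th_pi.
rewrite ord_subE inordK //; set q := Num.truncn _ in ltN le_th lt_th *.
have in_window k t : (k <= j + M)%N -> t < k%:R * w -> t < j%:R * w + alpha.
  move=> lek ltt; apply: lt_le_trans ltt _.
  apply: (@le_trans _ _ ((j + M)%:R * w)).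
    by rewrite ler_pM2r // ler_nat.
  by rewrite natrD mulrDl lerD2l.
case: (leqP j q) => [le_jq|lt_qj] ltM.
  exists (th e) => //; rewrite (in_window q.+1) ?andbT //; last by lia.
  by apply: le_trans le_th; rewrite ler_pM2r // ler_nat.
(* The window wraps past [pi]: the same line is represented by its angle plus a half-turn, which
   shifts the cell index by [N.+1]. *)
exists (th e + pi); last by move=> a c /dir; apply: has_directionDpi.
rewrite (in_window (q + N.+1).+1) ?andbT; last 2 first.
- by lia.
- by rewrite -addSn natrD mulrDl Nw ltrD2r.
rewrite -Nw -[leLHS]add0r lerD //; first by case/andP: th_pi.
by rewrite ler_pM2r // ler_nat ltnW.
Qed.

End AngleCrossingGraphs.

(** This is the passage to the limit in [N]: by the Archimedean property, a positive gap [x - y] has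
    a multiple exceeding [z]. *)
Lemma ler_of_bounded_multiples (R : realType) (x y z : R) :
  (forall N : nat, N.+1%:R * x <= N.+1%:R * y + z) -> x <= y.
Proof.
move=> H; rewrite leNgt; apply/negP => lt_yx.
have d_gt0 : 0 < x - y by rewrite subr_gt0.
have := truncnS_gt (z / (x - y)); rewrite ltr_pdivrMr // ltNge => /negP; apply.
by have := H (Num.truncn (z / (x - y))); rewrite mulrBr; lra.
Qed.

Theorem theorem1 (R : realType) (alpha : R) (n : nat) (G : geometric_graph R)
    (halpha0 : 0 < alpha) (halpha1 : alpha < pi / 2)
    (hn : #|vertex G| = n) (hn3 : (3 <= n)%N)
    (hG : is_alphaAC alpha G) :
  #|edges G|%:R <= pi / alpha * (3 * n%:R - 6).
Proof.
have pi0 := pi_gt0 R.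
have alpha_pi : alpha <= pi by lra.
suff: #|edges G|%:R * (alpha / pi) <= 3 * n%:R - 6 :> R.
  rewrite -ler_pdivlMr ?divr_gt0 // => /le_trans; apply.
  by rewrite invf_div mulrC.
(* Rounding [alpha / (pi / N.+1%:R)] down loses less than 1, so the error is at most one copy of the
   number of edges, independently of [N]. *)
apply: (@ler_of_bounded_multiples _ _ _ #|edges G|%:R) => N.
have V_gt2 : (2 < #|vertex G|)%N by rewrite hn.
have := card_edges_windows hG N halpha0 alpha_pi V_gt2.
rewrite hn -(ler_nat R) !natrM natrB ?(ltnW hn3) //.
set M := Num.truncn _ => le_M.
have lt_M : alpha / (pi / N.+1%:R) < M%:R + 1 by rewrite natr1 truncnS_gt.
have eqa : N.+1%:R * (#|edges G|%:R * (alpha / pi)) =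
    #|edges G|%:R * (alpha / (pi / N.+1%:R)) :> R.
  by rewrite invf_div; ring.
rewrite eqa; apply: (@le_trans _ _ (#|edges G|%:R * (M%:R + 1))).
  by rewrite ler_wpM2l // ltW.
by move: le_M; rewrite !mulrDr !mulr1 !mulrN; lra.
Qed.
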